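(* Let $\bar\gamma>0$ and $h$ be such that for every $\gamma$ with $0<\gamma<\bar\gamma$ the function $\tfrac1\gamma h-f$ is convex on $C$. Fix $\gamma\in(0,\bar\gamma)$ and put $\ell:=\tfrac1\gamma h-f$. Let $\{\mathbf{x}_k\}_{k\ge0}$ be the sequence generated by PGA-$\mathcal{B}$ with constant step size $\gamma_k\equiv\gamma$ for the problem $\min_{\mathbf{x}\in C}F(\mathbf{x})$, $F=f+g$, that is, $\mathbf{x}_0\in\mathrm{int}\,C$ and $$\mathbf{x}_{k+1}=\underset{\mathbf{x}\in C}{\operatorname{argmin}}\Big\{g(\mathbf{x})+\langle \mathbf{x},\nabla f(\mathbf{x}_k)\rangle+\tfrac{1}{\gamma}D_h(\mathbf{x},\mathbf{x}_k)\Big\}.$$ Then $$F(\mathbf{x}_{k+1})-F(\mathbf{x}_k)\le -D_\ell(\mathbf{x}_k,\mathbf{x}_{k+1})\quad\text{for all }k,$$ $$D_\ell(\mathbf{x}^*,\mathbf{x}_{k+1})\le D_\ell(\mathbf{x}^*,\mathbf{x}_k)\quad\text{for all }\mathbf{x}^*\in\mathcal{X}^*\text{ and all }k,$$ $$F(\mathbf{x}_k)-F(\mathbf{u})\le\frac{D_\ell(\mathbf{u},\mathbf{x}_0)}{k}\quad\text{for all }\mathbf{u}\in C\text{ and all }k\ge1.$$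
   Context: Setting: $C\subset\mathbb{R}^n$ is a closed convex set with interior $\mathrm{int}\,C$, and the problem is $\min_{\mathbf{x}\in C}F(\mathbf{x})$ with $F:=f+g$. Standing assumptions: (1) $f,g:\mathbb{R}^n\to(-\infty,+\infty]$ are proper, lower semicontinuous and convex; $f$ is differentiable on $\mathrm{int}\,C$; $\operatorname{dom} f\supset C$ and $\operatorname{dom} g\cap\mathrm{int}\,C\neq\emptyset$. (2) $F^*:=\inf_{\mathbf{x}\in C}F(\mathbf{x})>-\infty$ and the solution set $\mathcal{X}^*:=\{\mathbf{x}\in C: F(\mathbf{x})=F^*\}$ is non-empty. (3) $h:\mathbb{R}^n\to(-\infty,+\infty]$ has $\operatorname{dom} h=C$, is continuously differentiable on $\mathrm{int}\,C$, and is strictly convex on $C$. (4) The iteration steps of PGA-$\mathcal{B}$ are well defined: for every $k$ the minimizer defining $\mathbf{x}_{k+1}$ exists, is unique, and lies in $\mathrm{int}\,C$. Notation: for a function $\phi$ that is finite on $C$ and differentiable on $\mathrm{int}\,C$, and for $\mathbf{x}\in C$, $\mathbf{y}\in\mathrm{int}\,C$, set $D_\phi(\mathbf{x},\mathbf{y}):=\phi(\mathbf{x})-\phi(\mathbf{y})-\langle\mathbf{x}-\mathbf{y},\nabla\phi(\mathbf{y})\rangle$ (the Bregman distance of $\phi$ when $\phi$ is convex). Inequalities between function-value differences are read with the convention that $F(\mathbf{x}_k)-F(\mathbf{u})\le c$ holds trivially if $F(\mathbf{u})=+\infty$, and likewise $F(\mathbf{x}_{k+1})-F(\mathbf{x}_k)\le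 c$ if $F(\mathbf{x}_k)=+\infty$. *)

(* Defs.v *)
(* Points of R^n are row vectors 'rV[R]_n over a realType R;
   functions R^n -> (-oo, +oo] take values in \bar R and avoid -oo. *)
From HB Require Import structures.
From mathcomp Require Import all_boot all_order all_algebra.
From mathcomp Require Import all_classical all_reals all_analysis.

Set Implicit Arguments.
Unset Strict Implicit.
Unset Printing Implicit Defensive.

Import Order.TTheory GRing.Theory Num.Theory.
Import numFieldNormedType.Exports.

Local Open Scope classical_set_scope.
Local Open Scope ring_scope.
Local Open Scope ereal_scope.

Section Defs.
Context {R : realType} {n : nat}.
Local Notation V := 'rV[R]_n.
Implicit Types (C A : set V) (f g h phi : V -> \bar R) (x y : V).

Definition edom phi : set V := [set x | phi x < +oo].

Definition eproper phi : Prop :=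
  (forall x, -oo < phi x) /\ edom phi !=set0.

(* Restricting to 0 < t < 1 loses nothing and keeps products 0 * +oo out of
   the inequality. *)
Definition convex_on A phi : Prop :=
  forall x y (t : R), A x -> A y -> (0 < t < 1)%R ->
    phi (t *: x + (1 - t) *: y)%R <= t%:E * phi x + (1 - t)%:E * phi y.

Definition strictly_convex_on A phi : Prop :=
  forall x y (t : R), A x -> A y -> x <> y -> (0 < t < 1)%R ->
    phi (t *: x + (1 - t) *: y)%R < t%:E * phi x + (1 - t)%:E * phi y.

Definition dotv x y : R := (\sum_(i < n) x 0 i * y 0 i)%R.

(* [fine] is only harmless where phi is finite near the point: differentiability
   and gradients are used only at interior points of a set on which phi is
   finite. *)
Definition differentiable_on A phi : Prop :=
  forall x, A x -> differentiable (fine \o phi) x.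

Definition grad phi y : V := \row_(i < n) 'D_(delta_mx 0%R i) (fine \o phi) y.

Definition continuously_differentiable_on A phi : Prop :=
  differentiable_on A phi /\ {within A, continuous (grad phi)}.

Definition bregman phi x y : \bar R :=
  phi x - phi y - (dotv (x - y)%R (grad phi y))%:E.

Definition argmin A phi : set V :=
  [set x | A x /\ forall y, A y -> phi x <= phi y].

Definition pga_objective f g h (gamma : R) y : V -> \bar R :=
  fun x => g x + (dotv x (grad f y))%:E + gamma^-1%:E * bregman h x y.

(* x_ is a sequence generated with the step sizes gamma_ k. *)
Definition pga_sequence C f g h (gamma_ : nat -> R) (x_ : nat -> V) : Prop :=
  (C°)%classic (x_ 0%N) /\
  forall k, argmin C (pga_objective f g h (gamma_ k) (x_ k)) (x_ k.+1).

Definition pga_well_defined C f g h (gamma_ : nat -> R) (x_ : nat -> V)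
    : Prop :=
  forall k, let S := argmin C (pga_objective f g h (gamma_ k) (x_ k)) in
    (exists! z, S z) /\ S `<=` C°.

(* gamma^-1 h - f: meaningful on C, where h and f are finite (elsewhere it may
   be +oo - +oo, and its value there is never used). *)
Definition ell f h (gamma : R) : V -> \bar R :=
  fun x => gamma^-1%:E * h x - f x.

End Defs.

(* Main.v *)
(* Write l = h / gamma - f. For x = x_k and y = x_(k+1), comparing the objective
   at y and at y + t (u - y) and letting t -> 0+ gives
     g(y) - g(u) <= <u - y, grad f(x) + (grad h(y) - grad h(x)) / gamma>.
   Adding f(y) - f(u) <= <y - u, grad f(y)> turns the right-hand side into
   <u - y, grad l(y) - grad l(x)>, so the three-point identity yields
     F(y) - F(u) <= D_l(u, x) - D_l(u, y) - D_l(y, x)   for every u in C.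
   Since D_l >= 0, u = x_k gives the descent, u = x* the monotonicity of the
   distance to x*, and summing over k (F(x_k) is nonincreasing) the rate. *)
Require Import Defs.
From HB Require Import structures.
From mathcomp Require Import all_boot all_order all_algebra.
From mathcomp Require Import all_classical all_reals all_analysis.
From mathcomp Require Import ring lra.

Set Implicit Arguments.
Unset Strict Implicit.
Unset Printing Implicit Defensive.

Import Order.TTheory GRing.Theory Num.Theory.
Import numFieldNormedType.Exports.

Local Open Scope classical_set_scope.
Local Open Scope ring_scope.
Local Open Scope ereal_scope.

(** * Inner product, gradients and directional derivatives *)

Section Gradient.
Context {R : realType} {n : nat}.
Local Notation V := 'rV[R]_n.
Implicit Types (A C : set V) (f g h phi : V -> \bar R) (u v w x y z : V).
Local Open Scope ring_scope.

Lemma dotvDl u v w : dotv (u + v) w = dotv u w + dotv v w.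
Proof. by rewrite -big_split; apply: eq_bigr => i _; rewrite !mxE mulrDl. Qed.

Lemma dotvZl a u v : dotv (a *: u) v = a * dotv u v.
Proof. by rewrite mulr_sumr; apply: eq_bigr => i _; rewrite !mxE mulrA. Qed.

Lemma dotvBl u v w : dotv (u - v) w = dotv u w - dotv v w.
Proof. by rewrite dotvDl -scaleN1r dotvZl mulN1r. Qed.

Lemma dotvC u v : dotv u v = dotv v u.
Proof. by apply: eq_bigr => i _; rewrite mulrC. Qed.

Lemma dotvDr u v w : dotv u (v + w) = dotv u v + dotv u w.
Proof. by rewrite dotvC dotvDl !(dotvC u). Qed.

Lemma dotvBr u v w : dotv u (v - w) = dotv u v - dotv u w.
Proof. by rewrite dotvC dotvBl !(dotvC u). Qed.

Lemma dotvZr a u v : dotv u (a *: v) = a * dotv u v.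
Proof. by rewrite dotvC dotvZl dotvC. Qed.

(** Differentiability makes the directional derivative linear in [v]; expand [v] in the standard
    basis. *)
Lemma dotv_grad phi y v : differentiable (fine \o phi) y ->
  dotv v (grad phi y) = 'D_v (fine \o phi) y.
Proof.
move=> dphi; rewrite deriveE // {2}[v]row_sum_delta linear_sum.
by apply: eq_bigr => i _; rewrite linearZ /= mxE deriveE.
Qed.

(** A two-sided derivative equals its right limit, so bounds on the difference quotients at small
    positive [t] suffice; these are all that a segment inside a convex set provides. *)
Lemma derive_ge_ray (p : V -> R) y v (c : R) : derivable p y v ->
  (forall t, 0 < t < 1 -> t * c <= p (y + t *: v) - p y) -> c <= 'D_v p y.
Proof.
move=> dp pc; rewrite /derive cvg_at_rightE; last exact: dp.
apply: limr_ge; first by apply/cvg_ex; eexists; exact: cvg_dnbhs_at_right dp.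
near=> t; have t0 : 0 < t by near: t; exact: nbhs_right_gt.
have t1 : t < 1 by near: t; exact: nbhs_right_lt.
rewrite [leRHS](_ : _ = t^-1 * (p (y + t *: v) - p y)).
  by rewrite ler_pdivlMl // pc // t0.
by rewrite /= [t *: v + y]addrC.
Unshelve. all: by end_near. Qed.

Lemma convex_set_segment C x y t : convex_set C -> 0 < t < 1 ->
  C x -> C y -> C (t *: x + (1 - t) *: y).
Proof.
move=> cC /andP[t0 t1] Cx Cy.
have := cC x y (Itv01 (ltW t0) (ltW t1)).
by rewrite !inE => /(_ Cx Cy).
Qed.

Lemma convex_derive_le A phi y u : convex_set A -> convex_on A phi ->
  (forall x, A x -> phi x \is a fin_num) ->
  derivable (fine \o phi) y (u - y) -> A y -> A u ->
  'D_(u - y) (fine \o phi) y <= fine (phi u) - fine (phi y).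
Proof.
(* Convexity bounds increments of [phi] from above, so the ray lemma is applied to the opposite
   function. *)
move=> cA cphi fphi dphi Ay Au; rewrite -lerN2 -deriveN //.
apply: derive_ge_ray; first exact: derivableN.
move=> t t01.
have -> : y + t *: (u - y) = t *: u + (1 - t) *: y.
  by rewrite scalerBr scalerBl scale1r addrCA.
have := cphi u y t Au Ay t01.
have Az := convex_set_segment cA t01 Au Ay.
rewrite -(fineK (fphi _ Az)) -(fineK (fphi _ Au)) -(fineK (fphi _ Ay)).
rewrite -!EFinM -EFinD lee_fin !fctE /=.
lra.
Qed.

End Gradient.

(** * Bregman distances and one step of the iteration *)

Section Bregman.
Context {R : realType} {n : nat}.
Local Notation V := 'rV[R]_n.
Implicit Types (A C : set V) (f g h phi : V -> \bar R) (u v w x y z : V).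
Local Open Scope ring_scope.

(** A real-valued copy of [bregman], faithful where [phi] is finite, so that the estimates become
    real linear arithmetic. *)
Definition bregmanr phi x y : R :=
  fine (phi x) - fine (phi y) - dotv (x - y) (grad phi y).

Lemma bregmanE phi x y : phi x \is a fin_num -> phi y \is a fin_num ->
  bregman phi x y = (bregmanr phi x y)%:E.
Proof. by move=> fx fy; rewrite /bregman -(fineK fx) -(fineK fy). Qed.

Lemma bregmanr_xx phi x : bregmanr phi x x = 0.
Proof. by rewrite /bregmanr dotvBl !subrr. Qed.

Lemma bregmanr_three_point phi u x y :
  dotv (u - y) (grad phi y - grad phi x) =
  bregmanr phi u x - bregmanr phi u y - bregmanr phi y x.
Proof. by rewrite /bregmanr !dotvBr !dotvBl; ring. Qed.

Section Ell.
Context {C : set V} {f h : V -> \bar R} {gamma : R}.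
Context (f_fin : forall x, C x -> f x \is a fin_num)
  (h_fin : forall x, C x -> h x \is a fin_num).

Lemma ell_fin x : C x -> ell f h gamma x \is a fin_num.
Proof.
by move=> Cx; rewrite /ell fin_numB f_fin // andbT fin_numM // h_fin.
Qed.

Lemma fine_ell x : C x ->
  fine (ell f h gamma x) = gamma^-1 * fine (h x) - fine (f x).
Proof.
move=> Cx; rewrite /ell -[in LHS](fineK (f_fin Cx)).
by rewrite -[in LHS](fineK (h_fin Cx)).
Qed.

(** [fine] distributes over the difference only on [C], where [f] and [h] are finite; as [y] is
    interior, this covers a neighbourhood, which determines the derivative. *)
Lemma is_derive_ell y v : C° y ->
  differentiable (fine \o f) y -> differentiable (fine \o h) y ->
  is_derive y v (fine \o ell f h gamma)
    (gamma^-1 * 'D_v (fine \o h) y - 'D_v (fine \o f) y).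
Proof.
move=> Cy /(@diff_derivable _ _ _ _ _ v) /derivableP df.
move=> /(@diff_derivable _ _ _ _ _ v) /derivableP dh.
have dB := is_deriveB (is_deriveZ gamma^-1 dh) df.
apply: near_eq_is_derive dB.
by apply: filterS Cy => z Cz; rewrite /= fine_ell.
Qed.

Lemma grad_ell y : C° y ->
  differentiable (fine \o f) y -> differentiable (fine \o h) y ->
  grad (ell f h gamma) y = gamma^-1 *: grad h y - grad f y.
Proof.
move=> Cy df dh; apply/rowP => i; rewrite !mxE.
by have [_ ->] := is_derive_ell (delta_mx 0 i) Cy df dh.
Qed.

Lemma bregmanr_ell_ge0 x y : convex_set C -> convex_on C (ell f h gamma) ->
  differentiable (fine \o f) y -> differentiable (fine \o h) y ->
  C x -> C° y -> 0 <= bregmanr (ell f h gamma) x y.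
Proof.
move=> cC cl df dh Cx Cy.
rewrite subr_ge0 grad_ell // dotvBr dotvZr !dotv_grad //.
have [dl <-] := is_derive_ell (x - y) Cy df dh.
by apply: (convex_derive_le cC cl ell_fin dl) => //; exact: interior_subset.
Qed.

End Ell.

(** First-order optimality of [y] along the segment to [u]: [h] is differentiated, while the
    increment of [g], which may be nonsmooth, is only bounded by convexity. *)
Lemma pga_optimality C f g h gamma x y u : 0 < gamma -> convex_set C ->
  convex_on C g -> (forall z, -oo < g z)%E ->
  (forall z, C z -> h z \is a fin_num) -> differentiable (fine \o h) y ->
  C x -> argmin C (pga_objective f g h gamma x) y -> C u ->
  g y \is a fin_num -> g u \is a fin_num ->
  fine (g y) - fine (g u) <=
    dotv (u - y) (grad f x + gamma^-1 *: (grad h y - grad h x)).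
Proof.
move=> gamma0 cC cg gNoo hfin dh Cx [Cy ymin] Cu gy gu.
(* The goal times [gamma], rearranged to isolate on the right the derivative of [h] at [y] towards
   [u]. *)
suff : dotv (u - y) (grad h x) -
    gamma * (fine (g u) - fine (g y) + dotv (u - y) (grad f x)) <=
    dotv (u - y) (grad h y).
  move=> le_dir; rewrite -(ler_pM2l gamma0) dotvDr dotvZr dotvBr.
  by rewrite (mulrDr _ (dotv _ _)) mulVKf ?gt_eqF //; lra.
rewrite (dotv_grad _ dh); apply: derive_ge_ray; first exact: diff_derivable.
move=> t t01; set z := y + t *: (u - y).
have zE : z = t *: u + (1 - t) *: y.
  by rewrite /z scalerBr scalerBl scale1r addrCA.
have Cz : C z by rewrite zE; exact: convex_set_segment.
have gz_le : (g z <= (t * fine (g u) + (1 - t) * fine (g y))%:E)%E.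
  by rewrite zE EFinD !EFinM !fineK //; exact: cg.
have gz : g z \is a fin_num.
  by rewrite fin_numElt gNoo (le_lt_trans gz_le) // ltry.
(* Everything being finite, minimality at [z] is a real inequality; solved for [h z - h y], it is
   the increment bound sought. *)
have := ymin _ Cz; rewrite /pga_objective /bregman.
rewrite -(fineK gy) -(fineK gz) -(fineK (hfin _ Cx)) -(fineK (hfin _ Cy)).
rewrite -(fineK (hfin _ Cz)) -!EFinB -!EFinM -!EFinD lee_fin /=.
rewrite -(ler_pM2l gamma0) !(mulrDr gamma _ (gamma^-1 * _)) !mulVKf ?gt_eqF //.
move: gz_le; rewrite -(fineK gz) lee_fin => /(ler_wpM2l (ltW gamma0)).
rewrite /z !dotvBl !dotvDl !dotvZl !dotvBl -/z; lra.
Qed.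

Lemma pga_step C f g h gamma x y u (l := ell f h gamma) :
  0 < gamma -> convex_set C -> convex_on C f -> convex_on C g ->
  (forall z, -oo < g z)%E ->
  (forall z, C z -> f z \is a fin_num) ->
  (forall z, C z -> h z \is a fin_num) ->
  differentiable_on C° f -> differentiable_on C° h ->
  C° x -> C° y -> argmin C (pga_objective f g h gamma x) y -> C u ->
  g y \is a fin_num -> g u \is a fin_num ->
  fine (f y) + fine (g y) - (fine (f u) + fine (g u)) <=
    bregmanr l u x - bregmanr l u y - bregmanr l y x.
Proof.
move=> gamma0 cC cf cg gNoo ffin hfin df dh Cx Cy ymin Cu gy gu.
have Cx' := interior_subset Cx; have Cy' := interior_subset Cy.
have := pga_optimality gamma0 cC cg gNoo hfin (dh _ Cy) Cx' ymin Cu gy gu.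
(* [f] is linearised at the new point [y], so that its gradients at [x] and [y] combine with those
   of [h] into gradients of [l]. *)
have := convex_derive_le cC cf ffin (diff_derivable (df _ Cy)) Cy' Cu.
rewrite -dotv_grad; last exact: df.
rewrite -bregmanr_three_point.
rewrite (grad_ell ffin hfin Cy (df _ Cy) (dh _ Cy)).
rewrite (grad_ell ffin hfin Cx (df _ Cx) (dh _ Cx)).
by rewrite dotvDr !(dotvBr, dotvZr); lra.
Qed.

(** Were [g y] infinite, so would be the objective at [y], yet it is at most the finite value at
    [z]. *)
Lemma argmin_pga_fin_num C f g h gamma x y z :
  (forall w, -oo < g w)%E -> (forall w, C w -> h w \is a fin_num) ->
  C x -> argmin C (pga_objective f g h gamma x) y ->
  C z -> (g z < +oo)%E -> g y \is a fin_num.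
Proof.
move=> gNoo hfin Cx [Cy ymin] Cz gz; have := ymin _ Cz.
have gz' : g z \is a fin_num by rewrite fin_numElt gNoo.
rewrite /pga_objective !(@bregmanE h) ?hfin // -(fineK gz').
rewrite -!EFinM -!EFinD -addeA -EFinD fin_numElt gNoo /=.
by case: (g y) => [r||] //= _; rewrite ltry.
Qed.

End Bregman.

Theorem corollary1 (R : realType) (n : nat)
  (C : set 'rV[R]_n) (f g h : 'rV[R]_n -> \bar R)
  (F := fun x => f x + g x)
  (Fstar := ereal_inf [set F x | x in C])
  (Xstar := [set x | C x /\ F x = Fstar])
  (C_closed : closed C)
  (C_convex : convex_set C)
  (f_proper : eproper f)
  (f_lsc : lower_semicontinuous f)
  (f_convex : convex_on setT f)
  (g_proper : eproper g)
  (g_lsc : lower_semicontinuous g)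
  (g_convex : convex_on setT g)
  (f_diff : differentiable_on C° f)
  (f_dom : C `<=` edom f)
  (g_dom : edom g `&` C° !=set0)
  (F_bounded : -oo < Fstar)
  (Xstar_nonempty : Xstar !=set0)
  (h_gtNoo : forall x, -oo < h x)
  (h_dom : edom h = C)
  (h_C1 : continuously_differentiable_on C° h)
  (h_strictly_convex : strictly_convex_on C h)
  (gammabar : R)
  (gammabar_gt0 : (0 < gammabar)%R)
  (ell_convex : forall gamma : R, (0 < gamma < gammabar)%R ->
    convex_on C (ell f h gamma))
  (gamma : R)
  (gamma_itv : (0 < gamma < gammabar)%R)
  (x_ : nat -> 'rV[R]_n)
  (x_well_defined : pga_well_defined C f g h (fun=> gamma) x_)
  (x_pga : pga_sequence C f g h (fun=> gamma) x_) :
  [/\ forall k : nat,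
        F (x_ k.+1) - F (x_ k) <= - bregman (ell f h gamma) (x_ k) (x_ k.+1),
      forall (xstar : 'rV[R]_n) (k : nat), Xstar xstar ->
        bregman (ell f h gamma) xstar (x_ k.+1)
          <= bregman (ell f h gamma) xstar (x_ k)
    & forall (u : 'rV[R]_n) (k : nat), C u -> (1 <= k)%N ->
        F (x_ k) - F u <= bregman (ell f h gamma) u (x_ 0%N) * k%:R^-1%:E].
Proof.
have [[gamma0 _] [x0C xmin]] := (andP gamma_itv, x_pga).
have xC k : C° (x_ k).
  by case: k => [//|k]; have [_] := x_well_defined k; apply; exact: xmin.
have xC' k : C (x_ k) := interior_subset (xC k).
have ffin z : C z -> f z \is a fin_num.
  by move=> Cz; rewrite fin_numElt f_proper.1; exact: f_dom.
have hfin z : C z -> h z \is a fin_num.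
  by move=> Cz; rewrite fin_numElt h_gtNoo /=; rewrite -h_dom in Cz.
have gNoo := g_proper.1.
have cf : convex_on C f by move=> x y t _ _; exact: f_convex.
have cg : convex_on C g by move=> x y t _ _; exact: g_convex.
have [z [gz /interior_subset Cz]] := g_dom.
(* Only from index 1 on: [x_ 0] is not a minimizer and may lie outside the domain of [g]. *)
have gfin k : g (x_ k.+1) \is a fin_num.
  exact: argmin_pga_fin_num (xmin k) Cz gz.
pose l := ell f h gamma.
have lE u k : C u -> bregman l u (x_ k) = (bregmanr l u (x_ k))%:E.
  by move=> Cu; apply: bregmanE; exact: (ell_fin ffin hfin).
have l_ge0 u k : C u -> (0 <= bregmanr l u (x_ k))%R.
  move=> Cu; exact (bregmanr_ell_ge0 ffin hfin C_convex (ell_convex _ gamma_itv)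
    (f_diff _ (xC k)) (h_C1.1 _ (xC k)) Cu (xC k)).
have FE u : C u -> g u \is a fin_num -> F u = (fine (f u) + fine (g u))%:E.
  by move=> Cu gu; rewrite EFinD !fineK // ffin.
have F_infty u : C u -> g u \isn't a fin_num -> F u = +oo.
  rewrite /F fin_numElt gNoo /= -leNgt leye_eq => Cu /eqP ->.
  by rewrite addey // gt_eqF // f_proper.1.
have step u k : C u -> g u \is a fin_num ->
    (fine (f (x_ k.+1)) + fine (g (x_ k.+1)) - (fine (f u) + fine (g u)) <=
     bregmanr l u (x_ k) - bregmanr l u (x_ k.+1)
       - bregmanr l (x_ k.+1) (x_ k))%R.
  move=> Cu gu; exact (pga_step gamma0 C_convex cf cg gNoo ffin hfin f_diff
    h_C1.1 (xC k) (xC k.+1) (xmin k) Cu (gfin k) gu).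
have descent u k : C u -> g u \is a fin_num ->
    (fine (f (x_ k.+1)) + fine (g (x_ k.+1)) - (fine (f u) + fine (g u)) <=
     bregmanr l u (x_ k) - bregmanr l u (x_ k.+1))%R.
  move=> Cu gu; apply: le_trans (step u k Cu gu) _.
  by rewrite gerBl l_ge0.
split=> [k|xs k [Cxs Fxs]|u [//|k] Cu _].
- rewrite lE // (FE (x_ k.+1)) //.
  (* If [F (x_ k)] is [+oo], the left-hand side is a finite value minus [+oo], that is [-oo]. *)
  have [gk|gk] := boolP (g (x_ k) \is a fin_num); last first.
    by rewrite F_infty // addeNy leNye.
  rewrite FE // -EFinB -EFinN lee_fin.
  have := step _ k (xC' k) gk; have := l_ge0 _ k (xC' k.+1).
  by rewrite bregmanr_xx; lra.
- rewrite !lE // lee_fin.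
  have le_F : F xs <= F (x_ k.+1).
    by rewrite Fxs; apply: ereal_inf_lbound; exists (x_ k.+1).
  (* The optimal value is at most the finite [F (x_ k.+1)]. *)
  have gxs : g xs \is a fin_num.
    apply/negPn/negP => /(F_infty _ Cxs) Fy.
    by move: le_F; rewrite Fy FE // leye_eq.
  have := descent _ k Cxs gxs; move: le_F; rewrite !FE // lee_fin; lra.
- rewrite lE // (FE (x_ k.+1)) //.
  have [gu|gu] := boolP (g u \is a fin_num); last first.
    by rewrite F_infty // addeNy leNye.
  rewrite FE // -EFinB -EFinM lee_fin ler_pdivlMr ?ltr0n //.
  (* Keeping the term at [x_ k.+1] makes the bound telescope under induction; it is then dropped as
     nonnegative. Here [k.+1] is the iteration count of the statement. *)
  suff : ((fine (f (x_ k.+1)) + fine (g (x_ k.+1)) - (fine (f u) + fine (g u)))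
      * k.+1%:R <= bregmanr l u (x_ 0) - bregmanr l u (x_ k.+1))%R.
    by move=> /le_trans; apply; rewrite gerBl l_ge0.
  elim: k => [|k IH]; first by rewrite mulr1; exact: descent.
  (* Two instances of [descent]: at [u] for the new summand, and at [x_ k.+1], where the distance of
     the point to itself vanishes, for the decrease of [F]. *)
  have := descent _ k.+1 Cu gu; have := descent _ k.+1 (xC' k.+1) (gfin k).
  have := l_ge0 _ k.+2 (xC' k.+1); rewrite bregmanr_xx -[in X in _ -> X]natr1.
  move: IH; set a := (fine (f (x_ k.+1)) + _)%R.
  set b := (fine (f (x_ k.+2)) + _)%R.
  move=> IH Dge0 ba bu.
  have ba' : (b <= a)%R by lra.
  (* The decrease is weighted by [k.+1], replacing [a] by [b] in all earlier summands at once. *)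
  have := ler_wpM2r (ler0n R k.+1) ba'; lra.
Qed.
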